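(* Let $X$ be a complete complex variety with an action of $T=\mathbb{C}^\star$ with isolated fixed points, and let $\mathscr{L}$ be an ample $T$-equivariant line bundle on $X$. Let $v,w\in X$ be fixed points. Then $X_v\cap X^w\neq\emptyset$ only if $v=w$ or $\Phi(v)<\Phi(w)$.
   Context: For $T$-fixed points $v,w\in X$ define the Białynicki-Birula cells $$X_v^\circ=\{x\in X:\lim_{t\to0}t.x=v\},\qquad X^w_\circ=\{x\in X:\lim_{t\to\infty}t.x=w\},$$ and their closures $X_v=\overline{X_v^\circ}$, $X^w=\overline{X^w_\circ}$ in $X$. $\Phi(v)\in\mathbb{Z}$ denotes the $T$-weight of the fiber $\mathscr{L}|_v$. Sign convention: $t\in T$ acts on the (geometric) one-dimensional fiber $\mathscr{L}|_v$ by multiplication by $t^{-\Phi(v)}$; with this convention, for a non-constant orbit with limit $v$ as $t\to0$ and limit $w$ as $t\to\infty$, the pullback of $\mathscr{L}$ to $\mathbb{P}^1$ along the extended orbit map has degree $\Phi(w)-\Phi(v)$. *)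

(* Defs.v *)
(* Classical algebraic geometry over an algebraically closed field, in the
   language of spaces with functions. *)
From mathcomp Require Import all_boot all_order all_algebra.
From mathcomp Require Import classical_sets reals complex mpoly.

Set Implicit Arguments.
Unset Strict Implicit.
Unset Printing Implicit Defensive.

Import Order.TTheory GRing.Theory Num.Theory.
Local Open Scope classical_set_scope.
Local Open Scope ring_scope.

Section SpacesWithFunctions.
Variable k : closedFieldType.

(* [reg U f]: the restriction of f to the open set U is a regular function
   on U; the values of f outside U are irrelevant.  The axioms are in
   [is_fspace] below. *)
Record fspace := FSpace {
  pt :> Type;
  opn : set pt -> Prop;
  reg : set pt -> (pt -> k) -> Prop }.

Definition clsd (X : fspace) (Z : set X) : Prop := opn (~` Z).
Definition zclosure (X : fspace) (A : set X) : set X := smallest (@clsd X) A.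

(* The regular functions form a sheaf of k-algebras of functions, such that
   the locus where a regular function is nonzero is open and the inverse is
   regular there. *)
Record is_fspace (X : fspace) : Prop := IsFSpace {
  opnT : opn [set: X];
  opnI : forall U V : set X, opn U -> opn V -> opn (U `&` V);
  opn_bigU : forall F : set (set X), (forall U, F U -> opn U) ->
    opn (\bigcup_(U in F) U);
  reg_opn : forall (U : set X) f, reg U f -> opn U;
  reg_sub : forall (U V : set X) f, opn V -> V `<=` U -> reg U f -> reg V f;
  reg_glue : forall (U : set X) f, opn U ->
    (forall x, U x -> exists V g,
       [/\ V x, V `<=` U, reg V g & forall y, V y -> f y = g y]) ->
    reg U f;
  reg_cst : forall (U : set X) (c : k), opn U -> reg U (fun=> c);
  regD : forall (U : set X) f g, reg U f -> reg U g ->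
    reg U (fun x => f x + g x);
  regM : forall (U : set X) f g, reg U f -> reg U g ->
    reg U (fun x => f x * g x);
  regV : forall (U : set X) f, reg U f ->
    reg (U `&` [set x | f x != 0]) (fun x => (f x)^-1) }.

Definition regular_map (X Y : fspace) (phi : X -> Y) : Prop :=
  (forall V : set Y, opn V -> opn (phi @^-1` V)) /\
  (forall (V : set Y) (f : Y -> k), reg V f ->
     reg (phi @^-1` V) (fun x => f (phi x))).

Definition isomorphism (X Y : fspace) (phi : X -> Y) : Prop :=
  regular_map phi /\
  exists psi : Y -> X, [/\ regular_map psi, cancel phi psi & cancel psi phi].

Definition isomorphic (X Y : fspace) : Prop :=
  exists phi : X -> Y, isomorphism phi.

(* A subset with the induced topology and the functions that are locally
   restrictions of regular functions. *)
Definition sub_opn (X : fspace) (A : set X) (W : set {x : X | A x}) : Prop :=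
  exists2 V : set X, opn V & W = [set z | V (sval z)].

Definition subfspace (X : fspace) (A : set X) : fspace :=
  @FSpace {x : X | A x} (@sub_opn X A)
    (fun W f => sub_opn W /\
       forall z, W z -> exists V g,
         [/\ V (sval z), reg V g &
             forall z', W z' -> V (sval z') -> f z' = g (sval z')]).

(* The product in the category of spaces with functions; its topology is
   finer than the product topology in general. *)
Definition bireg (X Y : fspace) (U : set X) (V : set Y) (h : X * Y -> k) : Prop :=
  exists n (f : 'I_n -> X -> k) (g : 'I_n -> Y -> k),
    [/\ forall i, reg U (f i), forall i, reg V (g i) &
        h = fun z => \sum_(i < n) f i z.1 * g i z.2].

Definition prod_opn (X Y : fspace) (W : set (X * Y)) : Prop :=
  forall z, W z -> exists U V h,
    [/\ opn U /\ opn V, bireg U V h, (U `*` V) z, h z != 0 &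
        forall z', (U `*` V) z' -> h z' != 0 -> W z'].

Definition product (X Y : fspace) : fspace :=
  @FSpace (X * Y) (@prod_opn X Y)
    (fun W f => prod_opn W /\
       forall z, W z -> exists U V p q,
         [/\ opn U /\ opn V, bireg U V p /\ bireg U V q,
             (U `*` V) z, q z != 0 &
             forall z', W z' -> (U `*` V) z' -> q z' != 0 ->
               f z' = p z' / q z']).

Definition affine_opn n (W : set 'rV[k]_n) : Prop :=
  exists S : set {mpoly k[n]}, W = [set u | exists2 p, S p & p.@[u 0] != 0].

Definition affine_space n : fspace :=
  @FSpace 'rV[k]_n (@affine_opn n)
    (fun W f => affine_opn W /\
       forall u, W u -> exists p q : {mpoly k[n]}, q.@[u 0] != 0 /\
         forall u', W u' -> q.@[u' 0] != 0 -> f u' = p.@[u' 0] / q.@[u' 0]).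

(* Projective space as the set of lines in k^(n+1). *)
Definition line n : Type := {l : {vspace 'rV[k]_n.+1} | \dim l == 1%N}.

Definition proj_opn n (W : set (line n)) : Prop :=
  exists2 S : set {mpoly k[n.+1]},
    forall p, S p -> exists d, p \is d.-homog &
    W = [set l : line n | exists p (u : 'rV[k]_n.+1),
           [/\ S p, u \in sval l & p.@[u 0] != 0]].

Definition projective_space n : fspace :=
  @FSpace (line n) (@proj_opn n)
    (fun W f => proj_opn W /\
       forall l, W l -> exists (d : nat) (p q : {mpoly k[n.+1]}),
         [/\ p \is d.-homog, q \is d.-homog,
             exists2 u : 'rV[k]_n.+1, u \in sval l & q.@[u 0] != 0 &
             forall (l' : line n) (u : 'rV[k]_n.+1),
               W l' -> u \in sval l' -> q.@[u 0] != 0 ->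
               f l' = p.@[u 0] / q.@[u 0]]).

Definition is_affine (X : fspace) : Prop :=
  exists n (Z : set (affine_space n)), clsd Z /\ isomorphic X (subfspace Z).

(* Reduced and separated of finite type; reducible varieties are allowed. *)
Definition is_variety (X : fspace) : Prop :=
  [/\ is_fspace X,
      exists n (U : 'I_n -> set X),
        (forall i, opn (U i) /\ is_affine (subfspace (U i))) /\
        (forall x, exists i, U i x) &
      clsd ([set z | z.1 = z.2] : set (product X X))].

Definition is_complete (X : fspace) : Prop :=
  forall Y : fspace, is_variety Y ->
  forall Z : set (product X Y), clsd Z -> clsd ((fun z => z.2) @` Z : set Y).

Definition closed_embedding (X Y : fspace) (phi : X -> Y) : Prop :=
  exists (Z : set Y) (psi : X -> subfspace Z),
    [/\ clsd Z, isomorphism psi & forall x, phi x = sval (psi x)].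

(* Geometric line bundles.  E is the total space and s is the scalar
   multiplication of the fibers; on a one-dimensional fiber it determines the
   addition. *)
Definition trivialization (X E : fspace) (pi : E -> X) (s : k -> E -> E)
    (U : set X) (psi : product (subfspace U) (affine_space 1) ->
                       subfspace (pi @^-1` U)) : Prop :=
  [/\ isomorphism psi,
      forall y b, pi (sval (psi (y, b))) = sval y &
      forall y b (a : k), sval (psi (y, a *: b)) = s a (sval (psi (y, b)))].

Record line_bundle (X : fspace) := LineBundle {
  tot : fspace;
  proj : tot -> X;
  scl : k -> tot -> tot;
  tot_variety : is_variety tot;
  proj_regular : regular_map proj;
  locally_trivial : forall x, exists (U : set X) psi,
    [/\ opn U, U x & @trivialization X tot proj scl U psi] }.

Definition nonzero (X : fspace) (L : line_bundle X) (e : tot L) : Prop :=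
  scl 0 e <> e.

Definition is_trivial (X : fspace) (L : line_bundle X) : Prop :=
  exists psi, @trivialization X (tot L) (@proj X L) (@scl X L) setT psi.

Definition is_section (X : fspace) (L : line_bundle X) (s : X -> tot L) : Prop :=
  regular_map s /\ forall x, proj (s x) = x.

(* M is the tensor product of L and L': a morphism tau from the fibered
   product to M is bilinear on each fiber and sends a pair of bases to a
   basis.  The values of tau outside the fibered product are irrelevant. *)
Definition is_tensor (X : fspace) (L L' M : line_bundle X) : Prop :=
  exists tau : tot L -> tot L' -> tot M,
    regular_map ((fun z => tau (sval z).1 (sval z).2) :
      subfspace ([set z | proj z.1 = proj z.2] : set (product (tot L) (tot L')))
        -> tot M) /\
    forall e e', proj e = proj e' ->
      [/\ proj (tau e e') = proj e,
          forall a, tau (scl a e) e' = scl a (tau e e'),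
          forall a, tau e (scl a e') = scl a (tau e e') &
          nonzero e -> nonzero e' -> nonzero (tau e e')].

Fixpoint is_tensor_power (X : fspace) (L : line_bundle X) (m : nat)
    (M : line_bundle X) : Prop :=
  if m is m'.+1 then
    exists2 M', is_tensor_power L m' M' & is_tensor L M' M
  else is_trivial M.

(* Finitely many global sections without common zeros define a closed
   embedding x |-> [s_0(x) : ... : s_n(x)]; e is an auxiliary basis of the
   fiber at x. *)
Definition very_ample (X : fspace) (L : line_bundle X) : Prop :=
  exists n (s : 'I_n.+1 -> X -> tot L) (phi : X -> projective_space n),
    [/\ forall i, is_section (s i),
        closed_embedding phi &
        forall x, exists (e : tot L) (u : 'rV[k]_n.+1),
          [/\ proj e = x, nonzero e, forall i, s i x = scl (u 0 i) e, u != 0 &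
              sval (phi x) = <[u]>%VS]].

Definition ample (X : fspace) (L : line_bundle X) : Prop :=
  exists m M, [/\ (0 < m)%N, is_tensor_power L m M & very_ample M].

Definition Gm : fspace := subfspace ([set t | t 0 0 != 0] : set (affine_space 1)).

(* Actions of the one-dimensional torus; the value at t = 0 is irrelevant. *)
Record Gm_action (X : fspace) := GmAction {
  act :> k -> X -> X;
  act_regular : regular_map
    ((fun z => act (sval z.1 0 0) z.2) : product Gm X -> X);
  act1 : forall x, act 1 x = x;
  actM : forall t t' x, t != 0 -> t' != 0 -> act (t * t') x = act t (act t' x) }.

Definition fixed (X : fspace) (T : Gm_action X) : set X :=
  [set x | forall t, t != 0 -> T t x = x].

Definition isolated_fixed_points (X : fspace) (T : Gm_action X) : Prop :=
  forall x, fixed T x -> exists2 U : set X, opn U & U `&` fixed T = [set x].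

(* The limit at 0 (resp. at infinity) of an orbit is the value at 0 of an
   extension of t |-> t.x (resp. t |-> t^-1.x) to a morphism on the affine
   line. *)
Definition lim_zero (X : fspace) (T : Gm_action X) (x v : X) : Prop :=
  exists g : affine_space 1 -> X,
    [/\ regular_map g, g 0 = v &
        forall z : 'rV[k]_1, z 0 0 != 0 -> g z = T (z 0 0) x].

Definition lim_infty (X : fspace) (T : Gm_action X) (x w : X) : Prop :=
  exists g : affine_space 1 -> X,
    [/\ regular_map g, g 0 = w &
        forall z : 'rV[k]_1, z 0 0 != 0 -> g z = T (z 0 0)^-1 x].

Definition plus_cell (X : fspace) (T : Gm_action X) (v : X) : set X :=
  [set x | lim_zero T x v].
Definition minus_cell (X : fspace) (T : Gm_action X) (w : X) : set X :=
  [set x | lim_infty T x w].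

Record linearization (X : fspace) (T : Gm_action X) (L : line_bundle X) :=
  Linearization {
    lin_act :> Gm_action (tot L);
    lin_proj : forall t e, t != 0 -> proj (lin_act t e) = T t (proj e);
    lin_scl : forall t a e, t != 0 ->
      lin_act t (scl a e) = scl a (lin_act t e) }.

Definition fiber_weight (X : fspace) (T : Gm_action X) (L : line_bundle X)
    (TL : linearization T L) (v : X) (n : int) : Prop :=
  forall t e, t != 0 -> proj e = v -> TL t e = scl (t ^ (- n)) e.

End SpacesWithFunctions.

(* Main.v *)
Require Import Defs.
From mathcomp Require Import all_boot all_order all_algebra.
From mathcomp Require Import boolp classical_sets reals complex mpoly.
From mathcomp Require Import ring.

Set Implicit Arguments.
Unset Strict Implicit.
Unset Printing Implicit Defensive.

Import Order.TTheory GRing.Theory Num.Theory.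
Local Open Scope classical_set_scope.
Local Open Scope ring_scope.

(** Some tensor power of [L], of order [m] say, has sections that embed [X] in a
    projective space.  Divide them by the [m]-th power of the fiber variable: they
    become functions [F i] on the nonzero vectors [e] of [L], homogeneous of degree
    [-m], and the line of the vector [F e] determines the base point of [e]
    ([ample_coordinates]).  The torus acts on [L], so the coordinates can be
    followed along an orbit, [t |-> F (t . e)], without making the embedding
    equivariant.  Regular functions on the torus are Laurent polynomials, and for
    [e] in a small open set the exponents stay in a bounded range; hence the
    coefficients are regular functions of [e] ([orbit_laurent]).

    If the base point [x] of [e] lies in the cell of [v], then [F (t . e)] has no
    term of degree less than [m * Phi v], and its coefficient in this degree is
    proportional to [F] at [v] ([limit_leading_term]).  These are equations
    between regular functions, so they persist on the closure of the cell
    ([zclosure_leading_term]).  The same holds for the other cell with [t]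
    replaced by its inverse.

    For [x] in both closures, the exponents in [F (t . e)] therefore lie between
    [m * Phi v] and [m * Phi w].  As [F e] is not zero, [Phi v <= Phi w]; and if
    equality holds, [F (t . e)] has a single term, proportional both to [F] at [v]
    and to [F] at [w], so that [v = x = w] ([leading_terms_compare]). *)

(** * Polynomials and Laurent polynomials *)

Section Polynomials.
Variable k : numClosedFieldType.
Implicit Types (p q h : {poly k}) (f : k -> k).

Lemma poly_ext p q : (forall t, p.[t] = q.[t]) -> p = q.
Proof.
move=> pq; apply/eqP; rewrite -subr_eq0; apply: contraT => d0.
pose rs := [seq (i%:R : k) | i <- iota 0 (size (p - q))].
have := @max_poly_roots _ (p - q) rs d0; rewrite size_map size_iota ltnn.
apply; first by apply/allP=> x _; rewrite rootE !hornerE pq subrr.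
by rewrite map_inj_uniq ?iota_uniq // => i j /eqP; rewrite eqr_nat => /eqP.
Qed.

Lemma poly_ext_generic h p q :
  h != 0 -> (forall t, h.[t] != 0 -> p.[t] = q.[t]) -> p = q.
Proof.
move=> h0 pq; apply/(mulIf h0)/poly_ext => t; rewrite !hornerM.
by have [->|/pq ->] := eqVneq h.[t] 0; rewrite ?mulr0.
Qed.

Lemma poly_ext_neq0 p q : (forall t, t != 0 -> p.[t] = q.[t]) -> p = q.
Proof.
move=> pq; apply: (@poly_ext_generic 'X); rewrite ?polyX_eq0 // => t.
by rewrite hornerX => /pq.
Qed.

Lemma horner_neq0 p t : p.[t] != 0 -> p != 0.
Proof. by apply: contraNneq => ->; rewrite horner0. Qed.

Lemma polyXn_factor p :
  p != 0 -> exists r u, u.[0] != 0 /\ p = 'X^r * u.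
Proof.
move=> p0; have [r [u]] := multiplicity_XsubC p 0.
rewrite p0 subr0 /= => u0 ->; exists r, u; split=> //; exact: mulrC.
Qed.

Lemma coprimep_Xn r (u : {poly k}) : u.[0] != 0 -> coprimep ('X^r : {poly k}) u.
Proof.
move=> u0; apply: coprimep_expl.
by rewrite coprimep_sym -['X]subr0 coprimep_XsubC rootE.
Qed.

Lemma no_nonzero_root p :
  (forall t, t != 0 -> p.[t] != 0) -> exists r c, c != 0 /\ p = 'X^r * c%:P.
Proof.
move=> pn0; have p0 : p != 0 by apply: (horner_neq0 (pn0 1 (oner_neq0 _))).
have [r [u [u0 pE]]] := polyXn_factor p0.
suff /eqP/eq_leq/size1_polyC uE : size u == 1%N.
  by exists r, u`_0; rewrite -uE; split=> //; rewrite uE hornerC in u0.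
apply: contraT => /closed_rootP[t /rootP ut].
have [t0|/pn0] := eqVneq t 0; first by rewrite t0 in ut; rewrite ut eqxx in u0.
by rewrite pE hornerM ut mulr0 eqxx.
Qed.

Definition fraction_on f p q := forall t, t != 0 -> q.[t] != 0 -> f t * q.[t] = p.[t].

(** Fractions that represent [f] near the various points are equal as rational
    functions, so the reduced denominator divides all of them and has no zero
    except possibly 0: it is a monomial.  Only the size of one representing
    fraction enters the bound, so it holds uniformly when [f] varies in a
    family with fractions of bounded size. *)
Lemma laurent_of_local f D p0 q0 :
    (size p0 <= D)%N -> (size q0 <= D)%N -> q0 != 0 -> fraction_on f p0 q0 ->
    (forall t, t != 0 -> exists p q, q.[t] != 0 /\ fraction_on f p q) ->
  exists2 l : {poly k}, (size l <= D + D)%N & forall t, t != 0 -> f t * t ^+ D = l.[t].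
Proof.
move=> sp sq q00 fr0 loc.
have same p q : q != 0 -> fraction_on f p q -> p * q0 = p0 * q.
  move=> qn0 fr; apply: (@poly_ext_generic ('X * q * q0)).
    by rewrite !mulf_neq0 ?polyX_eq0.
  move=> t; rewrite !hornerM hornerX !mulf_eq0 !negb_or -andbA => /and3P[t0 qt q0t].
  by rewrite -fr // -fr0 //; ring.
pose d := gcdp p0 q0.
have dn0 : d != 0 by rewrite gcdp_eq0 negb_and q00 orbT.
have /dvdpP[p' p0E] : d %| p0 by exact: dvdp_gcdl.
have /dvdpP[q' q0E] : d %| q0 by exact: dvdp_gcdr.
have q'n0 : q' != 0 by move: q00; rewrite q0E mulf_eq0 negb_or => /andP[].
have cop : coprimep q' p'.
  rewrite coprimep_sym; have := @coprimep_div_gcd _ p0 q0.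
  by rewrite q00 orbT -/d {1}p0E {1}q0E !mulpK //; apply.
have same' p q : q != 0 -> fraction_on f p q -> p * q' = p' * q.
  by move=> qn0 /(same _ _ qn0); rewrite p0E q0E => e; apply: (mulIf dn0); ring: e.
have q'div p q : q != 0 -> fraction_on f p q -> q' %| q.
  move=> qn0 /(same' _ _ qn0) e; rewrite -(Gauss_dvdpr _ cop) -e; exact: dvdp_mull.
have q'nz t : t != 0 -> q'.[t] != 0.
  move=> t0; have [p [q [qt fr]]] := loc t t0.
  have /dvdpP[c qE] := q'div _ _ (horner_neq0 qt) fr.
  by move: qt; rewrite qE hornerM mulf_eq0 negb_or => /andP[].
have fE t : t != 0 -> f t * q'.[t] = p'.[t].
  move=> t0; have [p [q [qt fr]]] := loc t t0.
  have /(congr1 (horner^~ t)) := same' _ _ (horner_neq0 qt) fr.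
  rewrite !hornerM -fr // => e; apply: (mulIf qt); rewrite -e; ring.
have [r [c [c0 q'E]]] := no_nonzero_root q'nz.
have sizeM (u : {poly k}) : u != 0 -> (size u <= size (u * d)%R)%N.
  by move=> u0; apply: dvdp_leq; rewrite ?mulf_neq0 ?dvdp_mulr.
have rD : (r < D)%N.
  apply: leq_trans sq; apply: leq_trans (_ : size q' <= _)%N; last by rewrite q0E sizeM.
  by rewrite q'E mulrC mul_polyC size_scale // size_polyXn.
exists ('X^(D - r) * (c^-1 *: p')).
  have [->|p'0] := eqVneq p' 0; first by rewrite scaler0 mulr0 size_poly0.
  apply: leq_trans (size_mul_leq _ _) _; rewrite size_polyXn size_scale ?invr_eq0 //=.
  by apply: leq_add; rewrite ?leq_subr //; apply: leq_trans sp; rewrite p0E sizeM.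
move=> t t0; rewrite hornerM hornerXn hornerZ -fE // q'E hornerM hornerXn hornerC.
rewrite -{1}(subnK (ltnW rD)) exprD; field; exact: c0.
Qed.

(** Interpolation at 1, ..., K, by inverting a Vandermonde matrix. *)
Lemma coef_interpolation K : exists A : 'M[k]_K,
  forall l : {poly k}, (size l <= K)%N ->
  forall i : 'I_K, l`_i = \sum_(j < K) l.[j.+1%:R] * A j i.
Proof.
pose V : 'M[k]_K := Vandermonde K (\row_j j.+1%:R).
exists (invmx V) => l sl i.
have Vu : V \in unitmx.
  rewrite unitmxE det_Vandermonde unitfE; apply/prodf_neq0 => a _.
  apply/prodf_neq0 => b ab; rewrite !mxE subr_eq0 eqr_nat eqSS.
  by rewrite neq_ltn ab orbT.
have : (\row_j l`_j) = (\row_j l.[j.+1%:R]) *m invmx V.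
  apply: (canRL (mulmxK Vu)); apply/rowP => j; rewrite !mxE (horner_coef_wide _ sl).
  by apply: eq_bigr => a _; rewrite !mxE.
by move=> /rowP/(_ i); rewrite !mxE => ->; apply: eq_bigr => j _; rewrite !mxE.
Qed.

Lemma exprz2_inj : injective (fun n : int => (2 : k) ^ n).
Proof.
have aux (n : nat) : (2 : k) ^+ n = 1 -> n = 0%N.
  rewrite -natrX => /eqP; rewrite (eqr_nat _ _ 1) => /eqP; case: n => // n.
  by rewrite expnS => e2; have := dvdn_mulr (2 ^ n)%N (dvdnn 2); rewrite e2.
have u2 : (2 : k) \is a GRing.unit by rewrite unitfE pnatr_eq0.
move=> a b /= e; apply/eqP; rewrite -subr_eq0; apply/eqP.
have : (2 : k) ^ (a - b) = 1 by rewrite expfzDr ?pnatr_eq0 // e -expfzDr ?pnatr_eq0 // subrr.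
case: (a - b) => n; first by move=> /aux ->.
by rewrite NegzE => /(congr1 GRing.inv); rewrite invr1 invr_expz opprK => /aux.
Qed.

(** In [p.[t] = q.[1/t]] the left side has no pole at 0 and the right side none
    at infinity, so both are constant. *)
Lemma poly_inv_const p q :
  (forall t, t != 0 -> p.[t] = q.[t^-1]) -> p = (p.[0])%:P /\ p.[0] = q.[0].
Proof.
move=> pq; pose D := size q.
pose q' : {poly k} := \sum_(i < D) q`_i *: 'X^(D - i).
have e : 'X^D * p = q'.
  apply: poly_ext_neq0 => t t0.
  rewrite hornerM hornerXn pq // horner_coef mulr_sumr horner_sum.
  apply: eq_bigr => i _; rewrite hornerZ hornerXn exprVn expfB //.
  by rewrite mulrCA.
have sp : (size p <= 1)%N.
  have [->|p0] := eqVneq p 0; first by rewrite size_poly0.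
  rewrite -(leq_add2l D); have := congr1 (fun u : {poly k} => size u) e.
  rewrite mulrC size_mulXn // => ->; apply: leq_trans (size_sum _ _ _) _.
  apply/bigmax_leqP => i _.
  by apply: leq_trans (size_scale_leq _ _) _; rewrite size_polyXn addn1 ltnS leq_subr.
have pE : p = (p.[0])%:P by rewrite {1}(size1_polyC sp) horner_coef0.
split=> //.
have : q = (p.[0])%:P.
  by apply: poly_ext_neq0 => t t0; rewrite -{1}[t]invrK -pq ?invr_eq0 // pE !hornerC.
by move=> /(congr1 (horner^~ 0)); rewrite hornerC.
Qed.

End Polynomials.

(** * The order of a curve at the origin *)

Section Order.
Variable k : numClosedFieldType.

(** The germ at 0 of [A] is that of a rational function without pole at 0; nothing
    is said about [A] at the zeros of [q]. *)
Definition rational_at0 (A : k -> k) := exists p q : {poly k},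
  q.[0] != 0 /\ forall t, q.[t] != 0 -> A t * q.[t] = p.[t].

(** If [f t] and [f (2 * t)] are, up to a common factor, [A t] and [B t], with
    [A] and [B] regular at 0 and [B 0 = 2 ^ a A 0 != 0], then [a] is the order of
    [f] at 0: for a lowest order term [t ^ r u], the quotient of [f (2 * t)] by
    [f t] tends to [2 ^ r].  Any number of infinite order could replace 2. *)
Lemma laurent_order (I : Type) (f A B : I -> k -> k) (h : {poly k}) (a : int) (j : I) :
    (forall i, exists N (l : {poly k}), forall t, t != 0 -> f i t * t ^+ N = l.[t]) ->
    (forall i, rational_at0 (A i)) -> (forall i, rational_at0 (B i)) ->
    (forall i, B i 0 = 2 ^ a * A i 0) -> A j 0 != 0 -> h.[0] != 0 ->
    (forall t, t != 0 -> h.[t] != 0 ->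
       exists2 c, c != 0 & forall i, f i t = c * A i t /\ f i (2 * t) = c * B i t) ->
  exists c, forall i, exists q : {poly k},
    (forall t, t != 0 -> f i t = t ^ a * q.[t]) /\ q.[0] = c * A i 0.
Proof.
move=> lau ratA ratB B0 Aj0 h0 prop.
have [N [l lE]] := lau j.
have [pj [qj [qj0 Aj]]] := ratA j.
have [pj' [qj' [qj'0 Bj]]] := ratB j.
have pj0 : pj.[0] != 0 by rewrite -Aj // mulf_neq0.
have l0 : l != 0.
  apply: contraNneq pj0 => l0; suff -> : pj = 0 by rewrite horner0.
  apply: (@poly_ext_generic _ ('X * h * qj)).
    by rewrite !mulf_neq0 ?polyX_eq0 // ?(horner_neq0 h0) ?(horner_neq0 qj0).
  move=> t; rewrite !hornerM hornerX !mulf_eq0 !negb_or -andbA => /and3P[t0 ht qt].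
  have [c c0 /(_ j)[fE _]] := prop t t0 ht.
  have /eqP := lE t t0; rewrite l0 horner0 fE !mulf_eq0 expf_eq0 (negbTE t0) (negbTE c0) andbF.
  by rewrite orbF /= => /eqP AE; rewrite -Aj // AE mul0r.
have [r [u [u0 lu]]] := polyXn_factor l0.
have two0 : (2 : k) != 0 by rewrite pnatr_eq0.
(* The limit at 0 of [f j (2 * t) / f j t], computed in two ways. *)
have ra : r%:Z = N%:Z + a.
  apply: (@exprz2_inj k); rewrite expfzDr //= -!exprnP.
  have : 2 ^+ r *: ((u \Po (2 *: 'X)) * pj * qj') = 2 ^+ N *: (u * pj' * qj).
    apply: (@poly_ext_generic _ ('X * h * qj * qj')).
      by rewrite !mulf_neq0 ?polyX_eq0 // ?(horner_neq0 h0) ?(horner_neq0 qj0) ?(horner_neq0 qj'0).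
    move=> t; rewrite !hornerM hornerX !mulf_eq0 !negb_or -!andbA => /and4P[t0 ht qt q't].
    have [c c0 /(_ j)[fE f2E]] := prop t t0 ht.
    rewrite !hornerZ !hornerM horner_comp hornerZ hornerX -Aj // -Bj //.
    have t20 : 2 * t != 0 by rewrite mulf_neq0.
    have e1 := lE t t0; have e2 := lE _ t20.
    rewrite lu hornerM hornerXn fE in e1; rewrite lu hornerM hornerXn f2E in e2.
    apply: (mulfI c0); apply: (mulfI (expf_neq0 r t0)).
    transitivity (((2 * t) ^+ r * u.[2 * t]) * (c * A j t) * qj.[t] * qj'.[t]).
      by rewrite exprMn; ring.
    rewrite -e2 exprMn.
    transitivity (2 ^+ N * (c * A j t * t ^+ N) * (c * B j t) * qj.[t] * qj'.[t]).
      by ring.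
    by rewrite e1; ring.
  move=> /(congr1 (horner^~ 0)); rewrite !hornerZ !hornerM horner_comp hornerZ hornerX mulr0.
  rewrite -Aj // -Bj // B0 => e.
  apply: (mulIf (_ : u.[0] * A j 0 * qj.[0] * qj'.[0] != 0)); first by rewrite !mulf_neq0.
  by move: e; rewrite !mulrA => e; ring: e.
exists (u.[0] / A j 0) => i.
have [Ni [li liE]] := lau i.
have [pi [qi [qi0 Ai]]] := ratA i.
(* [f i t * A j t = f j t * A i t], with denominators cleared. *)
have e : li * 'X^N * (pj * qi) = 'X^(Ni + r) * (u * pi * qj).
  apply: (@poly_ext_generic _ ('X * h * qj * qi)).
    by rewrite !mulf_neq0 ?polyX_eq0 // ?(horner_neq0 h0) ?(horner_neq0 qj0) ?(horner_neq0 qi0).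
  move=> t; rewrite !hornerM hornerX !mulf_eq0 !negb_or -!andbA => /and4P[t0 ht qt q't].
  have [c c0 fcE] := prop t t0 ht.
  have e1 := lE t t0; rewrite lu hornerM hornerXn (fcE j).1 in e1.
  rewrite !hornerXn -liE // -Aj // -Ai // (fcE i).1 exprD.
  transitivity (t ^+ Ni * (t ^+ r * u.[t]) * A i t * qj.[t] * qi.[t]); last by ring.
  by rewrite -e1; ring.
have /dvdpP[q qE] : 'X^(Ni + r) %| li * 'X^N.
  rewrite -(@Gauss_dvdpl _ _ (pj * qi)) ?e ?dvdp_mulr //.
  by apply: coprimep_Xn; rewrite hornerM mulf_neq0.
exists q; split=> [t t0|].
  have := congr1 (horner^~ t) qE; rewrite !hornerM !hornerXn -liE // exprD => e1.
  have tr : t ^+ r = t ^+ N * t ^ a by rewrite exprnP ra expfzDr.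
  apply: (mulIf (expf_neq0 Ni t0)); apply: (mulIf (expf_neq0 N t0)); rewrite e1 tr.
  ring.
have e2 : q * (pj * qi) = u * pi * qj.
  apply: (mulfI (_ : 'X^(Ni + r) != 0 :> {poly k})); first by rewrite -size_poly_eq0 size_polyXn.
  by rewrite -e qE; ring.
have := congr1 (horner^~ 0) e2; rewrite !hornerM -Aj // -Ai // => e3.
apply: (mulIf qi0); apply: (mulIf qj0); apply: (mulIf Aj0).
transitivity (q.[0] * (A j 0 * qj.[0] * qi.[0])); first by ring.
by rewrite e3; field.
Qed.

End Order.

(** * Regular maps *)

Section Fspaces.
Variable k : closedFieldType.
Implicit Types X Y Z : fspace k.

Lemma opn0 X : is_fspace X -> opn (set0 : set X).
Proof.
move=> fX; have -> : (set0 : set X) = \bigcup_(U in (set0 : set (set X))) U.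
  by rewrite bigcup_set0.
exact: opn_bigU.
Qed.

Lemma opn_local X (W : set X) : is_fspace X ->
  (forall x, W x -> exists V, [/\ opn V, V x & V `<=` W]) -> opn W.
Proof.
move=> fX loc; have -> : W = \bigcup_(V in [set V | opn V /\ V `<=` W]) V.
  apply/seteqP; split=> [x /loc[V [oV Vx VW]]|x [V [_ VW] /VW //]].
  by exists V.
by apply: opn_bigU => // U [].
Qed.

Lemma zclosure_meets_open X (A U : set X) (z : X) : is_fspace X ->
  zclosure A z -> opn U -> U z -> exists2 y, U y & A y.
Proof.
move=> fX Az oU Uz; apply: contrapT => no.
have : (~` U) z; last exact.
by apply: Az; split=> [|y Ay Uy]; [rewrite /clsd setCK | apply: no; exists y].
Qed.

Lemma reg_eq X (U : set X) f g : is_fspace X ->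
  reg U f -> (forall x, U x -> f x = g x) -> reg U g.
Proof.
move=> fX rf fg; apply: reg_glue => //; first exact: reg_opn rf.
by move=> x Ux; exists U, f; split=> // y /fg.
Qed.

Lemma reg_sum X (U : set X) n (f : 'I_n -> X -> k) : is_fspace X -> opn U ->
  (forall i, reg U (f i)) -> reg U (fun x => \sum_(i < n) f i x).
Proof.
move=> fX oU; elim: n f => [|n IH] f rf.
  by apply: reg_eq (reg_cst fX 0 oU) _ => // x _; rewrite big_ord0.
apply: reg_eq (regD fX (rf ord0) (IH (fun i => f (lift ord0 i)) _)) _ => //.
by move=> x _; rewrite big_ord_recl.
Qed.

Lemma reg_div X (U : set X) f g : is_fspace X -> reg U f -> reg U g ->
  reg (U `&` [set x | g x != 0]) (fun x => f x / g x).
Proof.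
move=> fX rf rg; have rV := regV fX rg.
by apply: regM => //; apply: reg_sub rf => //; exact: reg_opn rV.
Qed.

(** A total map that is regular on an open set; its values elsewhere are
    irrelevant. *)
Definition regular_on X Y (U : set X) (phi : X -> Y) : Prop :=
  (forall V : set Y, opn V -> opn (U `&` phi @^-1` V)) /\
  (forall (V : set Y) f, reg V f -> reg (U `&` phi @^-1` V) (f \o phi)).

Lemma regular_onT X Y (phi : X -> Y) : regular_map phi -> regular_on setT phi.
Proof. by case=> o r; split=> V *; rewrite setTI; [apply: o|apply: r]. Qed.

Lemma regular_on_comp X Y Z U V (phi : X -> Y) (psi : Y -> Z) :
  regular_on U phi -> regular_on V psi -> regular_on (U `&` phi @^-1` V) (psi \o phi).
Proof.
move=> [o1 r1] [o2 r2]; split=> W; rewrite -setIA; first by move=> /o2 /o1.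
by move=> f /r2 /r1.
Qed.

Lemma regular_on_eq X Y U (phi psi : X -> Y) : is_fspace X ->
  regular_on U phi -> (forall x, U x -> phi x = psi x) -> regular_on U psi.
Proof.
move=> fX [o r] e; have pre W : U `&` psi @^-1` W = U `&` phi @^-1` W.
  by apply/seteqP; split=> x [Ux]; rewrite /= ?e // -e.
split=> W; first by rewrite pre; apply: o.
by move=> f rf; rewrite pre; apply: reg_eq (r _ _ rf) _ => // x [Ux _]; rewrite /= e.
Qed.

Lemma regular_on_cst X Y (U : set X) (y : Y) : is_fspace X -> opn U ->
  @regular_on X Y U (fun=> y).
Proof.
move=> fX oU; have pre (V : set Y) : opn (U `&` (fun=> y) @^-1` V).
  have [Vy|nVy] := pselect (V y).
    by rewrite (_ : _ `&` _ = U) //; apply/seteqP; split=> x // [].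
  by rewrite (_ : _ `&` _ = set0); [exact: opn0|apply/seteqP; split=> x // []].
by split=> V // f _; apply: (@reg_eq _ _ (fun=> f y)) => //; apply: reg_cst.
Qed.

Lemma regular_on_pair X Y Z U (phi : X -> Y) (psi : X -> Z) : is_fspace X ->
  regular_on U phi -> regular_on U psi ->
  @regular_on X (product Y Z) U (fun x => (phi x, psi x)).
Proof.
move=> fX [o1 r1] [o2 r2].
have bireg_reg A B h : @bireg _ Y Z A B h -> opn A -> opn B ->
    reg (U `&` (phi @^-1` A `&` psi @^-1` B)) (fun x => h (phi x, psi x)).
  move=> [n [f [g [rf rg ->]]]] oA oB.
  have -> : U `&` (phi @^-1` A `&` psi @^-1` B) =
      (U `&` phi @^-1` A) `&` (U `&` psi @^-1` B).
    by rewrite setIACA setIid.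
  have oAB : opn ((U `&` phi @^-1` A) `&` (U `&` psi @^-1` B)).
    by apply: opnI; [|apply: o1|apply: o2].
  apply: reg_sum => // i; apply: regM => //.
    by apply: reg_sub (r1 _ _ (rf i)) => // x [].
  by apply: reg_sub (r2 _ _ (rg i)) => // x [].
have oW (W : set (Y * Z)) : prod_opn W ->
    opn (U `&` (fun x => (phi x, psi x)) @^-1` W).
  move=> oW; apply: opn_local => // x [Ux Wx].
  have [A [B [h [[oA oB] hAB ABx hx sub]]]] := oW _ Wx.
  have rV := regV fX (bireg_reg _ _ _ hAB oA oB).
  exists (U `&` (phi @^-1` A `&` psi @^-1` B) `&` [set x | h (phi x, psi x) != 0]).
  split; [exact: reg_opn rV| by [] |].
  by move=> y [[Uy ABy] hy]; split=> //; apply: sub.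
split=> // W f [opW fW]; apply: reg_glue; [by []|exact: oW|].
move=> x [Ux Wx]; have [A [B [p [q [[oA oB] [pAB qAB] ABx qx fE]]]]] := fW _ Wx.
have := reg_div fX (bireg_reg _ _ _ pAB oA oB) (bireg_reg _ _ _ qAB oA oB).
set G := (X in reg X _) => rG.
have oG : opn (G `&` (U `&` (fun x => (phi x, psi x)) @^-1` W)).
  by apply: opnI; [|exact: reg_opn rG|exact: oW].
exists (G `&` (U `&` (fun x => (phi x, psi x)) @^-1` W)),
  (fun x => p (phi x, psi x) / q (phi x, psi x)); split.
- by [].
- by move=> y [].
- by apply: (reg_sub fX oG _ rG) => y [].
- by move=> y [[[_ ABy] qy] [_ Wy]]; apply: fE.
Qed.

(** [phi'] is [phi] with values in the subspace [A]; off [U] the values of [phi]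
    need not lie in [A]. *)
Lemma regular_on_corestrict X Y U (A : set Y) (phi : X -> Y)
    (phi' : X -> {y | A y}) : is_fspace X ->
  regular_on U phi -> (forall x, U x -> sval (phi' x) = phi x) ->
  @regular_on X (subfspace A) U phi'.
Proof.
move=> fX [o r] e.
have oW W : @sub_opn _ Y A W -> opn (U `&` phi' @^-1` W).
  move=> [V oV ->]; rewrite (_ : _ `&` _ = U `&` phi @^-1` V); first exact: o.
  by apply/seteqP; split=> x [Ux /=]; rewrite e.
split=> // W f [opW fW]; apply: reg_glue; [by []|exact: oW|].
move=> x [Ux Wx]; have [V [g [Vx rg fE]]] := fW _ Wx.
have rV := r _ _ rg.
exists (U `&` phi @^-1` V `&` (U `&` phi' @^-1` W)), (g \o phi); split.
- by split; split=> //=; rewrite -e.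
- by move=> y [].
- apply: (reg_sub fX _ _ rV); last by move=> y [].
  by apply: opnI => //; [exact: reg_opn rV|exact: oW].
- by move=> y [[Uy Vy] [_ Wy]] /=; rewrite -e //; apply: fE => //; rewrite e.
Qed.

Lemma regular_sval Y (A : set Y) : is_fspace Y ->
  regular_map (sval : subfspace A -> Y).
Proof.
move=> fY; split=> [V oV|V f rf]; first by exists V.
have oV := reg_opn fY rf; split; first by exists V.
by move=> z Vz; exists V, f.
Qed.

Lemma corestrict_exists T (A : set T) (y0 : T) : A y0 ->
  exists c : T -> {y | A y}, forall y, A y -> sval (c y) = y.
Proof.
move=> Ay0; pose c y := match pselect (A y) with
  | left Ay => exist A y Ay | right _ => exist A y0 Ay0 end.
by exists c => y Ay; rewrite /c; case: pselect.
Qed.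

Lemma regular_on_id X (U : set X) : is_fspace X -> opn U -> regular_on U (@id X).
Proof.
move=> fX oU; split=> V; first exact: opnI.
by move=> f rf; apply: (reg_sub fX _ _ rf) => [|x []//]; apply: opnI => //; exact: reg_opn rf.
Qed.

Lemma regular_on_compT X Y Z (U : set X) (phi : X -> Y) (psi : Y -> Z) :
  regular_on U phi -> regular_map psi -> regular_on U (psi \o phi).
Proof.
by move=> r /regular_onT/(regular_on_comp r); rewrite preimage_setT setIT.
Qed.

Lemma reg_comp X Y (U : set X) (phi : X -> Y) (V : set Y) f : is_fspace X ->
  regular_on U phi -> reg V f -> opn U -> U `<=` phi @^-1` V -> reg U (f \o phi).
Proof.
move=> fX [_ r] rf oU UV; apply: (reg_sub fX oU _ (r _ _ rf)).
by move=> x Ux; split=> //; apply: UV.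
Qed.

Lemma reg_sub1 X (A : set X) : is_fspace X -> reg (setT : set (subfspace A)) (fun=> 1).
Proof.
move=> fX; split; first by exists setT => //; apply: opnT.
by move=> z _; exists setT, (fun=> 1); split=> //; apply/reg_cst/opnT.
Qed.

Lemma reg_coord : reg (setT : set (affine_space k 1)) (fun u => u 0 0).
Proof.
split.
  exists [set 1%R]; apply/seteqP; split=> // u _; exists 1 => //.
  by rewrite meval1 oner_neq0.
move=> u _; exists 'X_ord0, 1; split=> [|u' _ _]; first by rewrite meval1 oner_neq0.
by rewrite mevalXU meval1 divr1.
Qed.

Lemma reg_affine1 : reg (setT : set (affine_space k 1)) (fun=> 1).
Proof.
split; first by case: reg_coord.
by move=> u _; exists 1, 1; rewrite meval1; split=> [|u' _ _]; rewrite ?meval1 ?divr1 ?oner_neq0.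
Qed.

Lemma reg_snd X Y g : opn (setT : set X) -> opn (setT : set Y) ->
  reg (setT : set X) (fun=> 1) -> reg (setT : set Y) (fun=> 1) ->
  reg (setT : set Y) g -> reg (setT : set (product X Y)) (fun z => g z.2).
Proof.
move=> oX oY r1X r1Y rg.
have b1 h : reg setT h -> @bireg k X Y setT setT (fun z => h z.2).
  move=> rh; exists 1%N, (fun _ _ => 1), (fun _ => h).
  by split=> //; apply: funext => z; rewrite big_ord1 mul1r.
split=> z _; first exists setT, setT, (fun=> 1); last exists setT, setT, (fun z => g z.2), (fun=> 1).
  by split=> //; [exact: (b1 (fun=> 1))|exact: oner_neq0].
split=> //; first by split; [exact: b1|exact: (b1 (fun=> 1))].
  exact: oner_neq0.
by move=> z' _ _ _; rewrite divr1.
Qed.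

End Fspaces.

(** * Line bundles *)

Section LineBundles.
Variable k : closedFieldType.
Variable X : fspace k.
Hypothesis fX : is_fspace X.
Implicit Types L M : line_bundle X.

(** A local trivialization as a generator [sigma] and the coordinate [beta] that it
    defines, both as total functions with arbitrary values away from [U]. *)
Record is_frame L (U : set X) (sigma : X -> tot L) (beta : tot L -> k) : Prop := IsFrame {
  frame_opn : opn U;
  frame_regular : regular_on U sigma;
  frame_proj : forall y a, U y -> proj (scl a (sigma y)) = y;
  frame_scl1 : forall y, U y -> scl 1 (sigma y) = sigma y;
  frame_sclA : forall y a b, U y -> scl a (scl b (sigma y)) = scl (a * b) (sigma y);
  frame_reg : reg ((@proj _ X L) @^-1` U) beta;
  frame_coord : forall y a, U y -> beta (scl a (sigma y)) = a;
  frameK : forall e, U (proj e) -> e = scl (beta e) (sigma (proj e)) }.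

Lemma is_fspace_tot L : is_fspace (tot L).
Proof. by case: (tot_variety L). Qed.

Lemma frame_exists L x : exists U sigma beta, is_frame (L := L) U sigma beta /\ U x.
Proof.
have fE := is_fspace_tot L.
have [U [psi [oU Ux [[rpsi [psi' [rpsi' K K']]] prpsi sclpsi]]]] := locally_trivial L x.
have [c cE] := corestrict_exists Ux.
pose one : affine_space k 1 := const_mx 1.
pose sigma y : tot L := sval (psi (c y, one)).
have Ue : ((@proj _ X L) @^-1` U) (sigma x) by rewrite /preimage /= prpsi cE.
have [d dE] := corestrict_exists Ue.
pose beta e := (psi' (d e)).2 0 0.
have sclE y a : scl a (sigma y) = sval (psi (c y, a *: one)) by rewrite sclpsi.
have oUE : opn ((@proj _ X L) @^-1` U) by case: (proj_regular L) => o _; apply: o.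
exists U, sigma, beta; split=> //; split=> //.
- have r1 : @regular_on _ X (subfspace U) U c.
    by apply: (regular_on_corestrict fX (regular_on_id fX oU)) => y /cE.
  have r2 : @regular_on _ X (affine_space k 1) U (fun=> one) by apply: regular_on_cst.
  have r3 := regular_on_compT (regular_on_pair fX r1 r2) rpsi.
  exact: regular_on_compT r3 (regular_sval _ fE).
- by move=> y a Uy; rewrite sclE prpsi cE.
- by move=> y Uy; rewrite sclE scale1r.
- by move=> y a b Uy; rewrite !sclE -sclpsi scalerA.
- pose E := (@proj _ X L) @^-1` U.
  have r1 : @regular_on _ (tot L) (subfspace E) E d.
    by apply: (@regular_on_corestrict _ _ _ E E id d fE (regular_on_id fE oUE)) => y /dE.
  have r2 := regular_on_compT r1 rpsi'.
  have r3 := @reg_snd _ (subfspace U) (affine_space k 1) (fun u => u 0 0).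
  apply: (reg_comp fE r2 (r3 _ _ _ _ _) oUE) => //.
  + by exists setT => //; apply: opnT.
  + by case: (reg_coord k).
  + exact: reg_sub1.
  + exact: reg_affine1.
  + exact: reg_coord.
- move=> y a Uy; rewrite /beta sclE.
  have -> : d (sval (psi (c y, a *: one))) = psi (c y, a *: one).
    by apply: eq_sig_hprop => [? ? ?|]; [exact: Prop_irrelevance|rewrite dE // /preimage /= prpsi cE].
  by rewrite K !mxE mulr1.
- move=> e Ue'; rewrite sclE.
  have eE : psi (psi' (d e)) = d e by rewrite K'.
  have pE : c (proj e) = (psi' (d e)).1.
    apply: eq_sig_hprop => [? ? ?|]; first exact: Prop_irrelevance.
    rewrite cE // -(prpsi _ (psi' (d e)).2) -surjective_pairing eE dE //.
  have -> : beta e *: one = (psi' (d e)).2.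
    by apply/matrixP => i j; rewrite !mxE !ord1 mulr1.
  by rewrite pE -surjective_pairing eE dE.
Qed.

Section FrameTheory.
Variables (L : line_bundle X) (U : set X) (sigma : X -> tot L) (beta : tot L -> k).
Hypothesis fr : is_frame U sigma beta.

Lemma coordZ a e : U (proj e) -> beta (scl a e) = a * beta e.
Proof. by move=> Ue; rewrite (frameK fr Ue) (frame_sclA fr) // !(frame_coord fr). Qed.

Lemma nonzeroE e : U (proj e) -> (nonzero e <-> beta e != 0).
Proof.
move=> Ue; split=> [n0|/eqP b0 e0]; last by apply: b0; rewrite -e0 coordZ // mul0r.
apply/eqP => b0; apply: n0; rewrite (frameK fr Ue) (frame_sclA fr) //.
by rewrite b0 mul0r.
Qed.

Lemma frame_section x : U x -> proj (sigma x) = x.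
Proof. by move=> Ux; rewrite -(frame_scl1 fr Ux) (frame_proj fr). Qed.

Lemma frame_nonzero x : U x -> nonzero (sigma x).
Proof.
move=> Ux; apply/nonzeroE; rewrite ?frame_section //.
by rewrite -(frame_scl1 fr Ux) (frame_coord fr) ?oner_neq0.
Qed.

End FrameTheory.

Lemma proj_scl L a (e : tot L) : proj (scl a e) = proj e.
Proof.
have [U [s [b [fr Ux]]]] := frame_exists L (proj e).
by rewrite (frameK fr Ux) (frame_sclA fr) // !(frame_proj fr).
Qed.

Lemma sclA L a b (e : tot L) : scl a (scl b e) = scl (a * b) e.
Proof.
have [U [s [c [fr Ux]]]] := frame_exists L (proj e).
by rewrite (frameK fr Ux) !(frame_sclA fr) // mulrA.
Qed.

Lemma scl1 L (e : tot L) : scl 1 e = e.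
Proof.
have [U [s [c [fr Ux]]]] := frame_exists L (proj e).
by rewrite {1}(frameK fr Ux) (frame_sclA fr) // mul1r -(frameK fr Ux).
Qed.

Lemma scl_inj L a b (e : tot L) : nonzero e -> scl a e = scl b e -> a = b.
Proof.
have [U [s [c [fr Ux]]]] := frame_exists L (proj e).
move=> /(nonzeroE fr Ux) ce /(congr1 c); rewrite !(coordZ fr) //; exact: mulIf.
Qed.

Lemma nonzero_scl L a (e : tot L) : a != 0 -> nonzero e -> nonzero (scl a e).
Proof.
have [U [s [c [fr Ux]]]] := frame_exists L (proj e).
move=> a0 /(nonzeroE fr Ux) ce; apply/(nonzeroE fr); rewrite ?proj_scl //.
by rewrite (coordZ fr) // mulf_neq0.
Qed.

Lemma fiber_spanned L (e e' : tot L) : nonzero e -> proj e' = proj e ->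
  exists a, e' = scl a e.
Proof.
have [U [s [c [fr Ux]]]] := frame_exists L (proj e).
move=> /(nonzeroE fr Ux) ce pe; exists (c e' / c e).
rewrite {2}(frameK fr Ux) (frame_sclA fr) // mulfVK // -pe.
by apply: (frameK fr); rewrite pe.
Qed.

Lemma nonzero_fiber_spanned L (e e' : tot L) : nonzero e -> nonzero e' ->
  proj e' = proj e -> exists2 a, a != 0 & e' = scl a e.
Proof.
move=> ne ne' /(fiber_spanned ne)[a e'E]; exists a => //.
by apply/eqP => a0; apply: ne'; rewrite e'E sclA a0 mul0r.
Qed.

Lemma opn_nonzero L : opn (nonzero (L := L) : set (tot L)).
Proof.
have fE := is_fspace_tot L.
apply: opn_local => // e ne; have [U [s [c [fr Ux]]]] := frame_exists L (proj e).
have rV := regV fE (frame_reg fr).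
exists ((@proj _ X L) @^-1` U `&` [set e | c e != 0]); split.
- exact: reg_opn rV.
- by split=> //; apply/(nonzeroE fr).
- by move=> e' [Ue' ce']; apply/(nonzeroE fr).
Qed.

Lemma proj_regular_on L : regular_on setT (@proj _ X L).
Proof. exact/regular_onT/proj_regular. Qed.

(** The map [e |-> e (x) ... (x) e].  For [m = 0] it is the constant section 1 of
    the trivial bundle. *)
Lemma tensor_power_map L m M : is_tensor_power L m M ->
  exists P : tot L -> tot M,
    [/\ regular_on setT P, forall e, proj (P e) = proj e,
        forall a e, P (scl a e) = scl (a ^+ m) (P e) &
        forall e, nonzero e -> nonzero (P e)].
Proof.
have fE := is_fspace_tot L.
have oE : opn (setT : set (tot L)) by apply: opnT.
elim: m M => [|m IH] M /=.
  move=> [psi [[rpsi [psi' [rpsi' K K']]] prpsi sclpsi]].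
  pose one : affine_space k 1 := const_mx 1.
  pose c x : subfspace (setT : set X) := exist _ x I.
  pose P (e : tot L) : tot M := sval (psi (c (proj e), one)).
  exists P; split.
  - have r1 : @regular_on _ (tot L) (subfspace (setT : set X)) setT (fun e => c (proj e)).
      exact: (regular_on_corestrict fE (proj_regular_on L)).
    have r2 : @regular_on _ (tot L) (affine_space k 1) setT (fun=> one).
      exact: regular_on_cst.
    have r3 := regular_on_compT (regular_on_pair fE r1 r2) rpsi.
    exact: regular_on_compT r3 (regular_sval _ (is_fspace_tot M)).
  - by move=> e; rewrite prpsi.
  - by move=> a e; rewrite /P proj_scl expr0 scl1.
  - move=> e _ P0; have : (c (proj e), 0 *: one) = (c (proj e), one).
      apply: (can_inj K); apply: eq_sig_hprop => [? ? ?|]; first exact: Prop_irrelevance.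
      by rewrite sclpsi.
    by case=> /matrixP/(_ 0 0)/eqP; rewrite !mxE mul0r eq_sym oner_eq0.
move=> [M' /IH[P' [rP' prP' sP' nP']] [tau [rtau tauP]]].
exists (fun e => tau e (P' e)); split.
- pose A : set (product (tot L) (tot M')) := [set z | proj z.1 = proj z.2].
  have Ae (e : tot L) : A (e, P' e) by rewrite /A /= prP'.
  pose c (e : tot L) : subfspace A := exist _ (e, P' e) (Ae e).
  have r1 := regular_on_pair fE (regular_on_id fE oE) rP'.
  have r2 : @regular_on _ (tot L) (subfspace A) setT c.
    exact: (regular_on_corestrict fE r1).
  exact: regular_on_compT r2 rtau.
- by move=> e; have [] := tauP e (P' e) (esym (prP' e)).
- move=> a e; rewrite sP'.
  have pe := esym (prP' e).
  have [_ t1 _ _] : _ := tauP e (scl (a ^+ m) (P' e)) (etrans pe (esym (proj_scl _ _))).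
  have [_ _ t2 _] := tauP e (P' e) pe.
  by rewrite t1 t2 sclA -exprS.
- move=> e ne; have [_ _ _] := tauP e (P' e) (esym (prP' e)); apply=> //; exact: nP'.
Qed.

End LineBundles.

Section HomogeneousCoordinates.
Variables (k : closedFieldType) (X : fspace k).
Hypothesis fX : is_fspace X.

(** The functions [F i] are the homogeneous coordinates of an injective map from
    [X] to projective space, as functions on the nonzero vectors of [L]. *)
Record is_coordinates (L : line_bundle X) m n (F : 'I_n -> tot L -> k) : Prop :=
  IsCoordinates {
  coordinates_reg : forall i, reg (nonzero (L := L)) (F i);
  coordinates_scl : forall i a e, a != 0 -> nonzero e ->
    F i (scl a e) = (a ^+ m)^-1 * F i e;
  coordinates_neq0 : forall e, nonzero e -> exists i, F i e != 0;
  coordinates_inj : forall e e' c, c != 0 -> nonzero e -> nonzero e' ->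
    (forall i, F i e = c * F i e') -> proj e = proj e' }.

(** [F i e] is the [i]-th section at the base point of [e], divided by
    [e (x) ... (x) e]. *)
Lemma ample_coordinates (L : line_bundle X) : ample L ->
  exists m n (F : 'I_n -> tot L -> k), (0 < m)%N /\ is_coordinates m F.
Proof.
move=> [m [M [m0 Lm [n [s [phi [sec emb va]]]]]]].
have fE := is_fspace_tot L.
have [P [rP prP sP nP]] := tensor_power_map fX Lm.
have /boolp.choice[F FE] (z : 'I_n.+1 * tot L) : exists a,
    nonzero z.2 -> s z.1 (proj z.2) = scl a (P z.2).
  have [ne|nne] := pselect (nonzero z.2); last by exists 0.
  have ps : proj (s z.1 (proj z.2)) = proj (P z.2) by rewrite prP (sec z.1).2.
  by have [a ->] := fiber_spanned fX (nP _ ne) ps; exists a.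
have uE e : nonzero e -> exists b (u : 'rV[k]_n.+1),
    [/\ b != 0, u != 0, forall i, u 0 i = b * F (i, e) & sval (phi (proj e)) = <[u]>%VS].
  move=> ne; have [e' [u [pe' ne' su u0 pu]]] := va (proj e).
  have [b b0 Pb] : exists2 b, b != 0 & P e = scl b e'.
    by apply: (nonzero_fiber_spanned fX) => //; [exact: nP|rewrite prP].
  exists b, u; split=> // i; apply: (scl_inj fX ne').
  by rewrite -su (FE (i, e) ne) /= Pb (sclA fX) mulrC.
exists m, n.+1, (fun i e => F (i, e)); split=> //; split.
- move=> i; apply: reg_glue => //; first exact: opn_nonzero.
  move=> e ne; have [U [si [be [fr Ux]]]] := frame_exists fX M (proj e).
  have rb := frame_reg fr.
  have oU : opn ((@proj _ X L) @^-1` U) by case: (proj_regular L) => o _; apply/o/(frame_opn fr).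
  have r1 : reg ((@proj _ X L) @^-1` U) (be \o P).
    by apply: (reg_sub fE oU _ (rP.2 _ _ rb)) => e' Ue'; split=> //; rewrite /preimage /= prP.
  have r2 : reg ((@proj _ X L) @^-1` U) (be \o (s i \o @proj _ X L)).
    have rs := regular_on_compT (proj_regular_on L) (sec i).1.
    by apply: (reg_sub fE oU _ (rs.2 _ _ rb)) => e' Ue'; split=> //; rewrite /preimage /= (sec i).2.
  have := reg_div fE r2 r1; set W := (X in reg X _) => rW.
  have oW : opn (W `&` nonzero (L := L)).
    by apply: opnI => //; [exact: reg_opn rW|exact: opn_nonzero].
  have bP e' : nonzero e' -> U (proj e') -> be (P e') != 0.
    by move=> ne' Ue'; apply/(nonzeroE fr); rewrite ?prP //; exact: nP.
  exists (W `&` nonzero (L := L)), (fun e => be (s i (proj e)) / be (P e)); split.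
  + by split=> //; split=> //=; apply: bP.
  + by move=> ? [].
  + by apply: (reg_sub fE oW _ rW) => ? [].
  + move=> e' [[Ue' _] ne']; rewrite (FE (i, e') ne') /= (coordZ fr) ?prP //.
    by rewrite mulfK // bP.
- move=> i a e a0 ne; apply: (mulfI (expf_neq0 m a0)); rewrite mulVKf ?expf_neq0 //.
  apply: (scl_inj fX (nP _ ne)); rewrite -(FE (i, e) ne) mulrC -(sclA fX) -sP.
  by rewrite -(FE (i, scl a e)) /= ?(proj_scl fX) //; apply: nonzero_scl.
- move=> e ne; have [b [u [b0 u0 uF _]]] := uE e ne.
  have [i ui] : exists i, u 0 i != 0.
    apply: contrapT => no; move/eqP: u0; apply; apply/rowP => i; rewrite mxE.
    by apply/eqP; apply: contrapT => /negP ui; apply: no; exists i.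
  by exists i; move: ui; rewrite uF mulf_eq0 negb_or => /andP[].
- move=> e e' c c0 ne ne' Fc.
  have [b [u [b0 u0 uF pu]]] := uE e ne.
  have [b' [u' [b'0 u'0 u'F pu']]] := uE e' ne'.
  have uu' : u = (b * c / b') *: u'.
    by apply/rowP => i; rewrite mxE uF u'F Fc; field.
  have : phi (proj e) = phi (proj e').
    apply: val_inj; rewrite /= pu pu'; apply/vspaceP => z.
    apply/vlineP/vlineP => -[d ->]; first by exists (d * (b * c / b')); rewrite uu' scalerA.
    exists (d / (b * c / b')); rewrite uu' scalerA; congr (_ *: _).
    by field; rewrite b0 b'0 c0.
  have [Z [psi [_ [_ [psi' [_ K _]]] phiE]]] := emb.
  rewrite !phiE => /eq_sig_hprop e1; apply: (can_inj K); apply: e1 => ? ? ?.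
  exact: Prop_irrelevance.
Qed.

End HomogeneousCoordinates.

(** * Regular functions on the line and the torus *)

Section LineAndTorus.
Variable k : closedFieldType.

Lemma meval1_horner (p : {mpoly k[1]}) :
  exists P : {poly k}, forall u : 'rV[k]_1, p.@[u 0] = P.[u 0 0].
Proof.
exists (\sum_(m <- msupp p) p@_m *: 'X^(m ord0)) => u.
rewrite mevalE horner_sum; apply: eq_bigr => m _.
by rewrite big_ord1 hornerZ hornerXn.
Qed.

Lemma opn_line (W : set (affine_space k 1)) u0 : opn W -> W u0 ->
  exists h : {poly k}, h.[u0 0 0] != 0 /\ forall u : 'rV_1, h.[u 0 0] != 0 -> W u.
Proof.
move=> [S ->] [p Sp pu]; have [h hE] := meval1_horner p.
by exists h; rewrite -hE; split=> // u; rewrite -hE => hu; exists p.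
Qed.

Lemma reg_line (W : set (affine_space k 1)) f u0 : reg W f -> W u0 ->
  exists p q : {poly k}, q.[u0 0 0] != 0 /\
    forall u : 'rV_1, q.[u 0 0] != 0 -> W u /\ f u * q.[u 0 0] = p.[u 0 0].
Proof.
move=> [oW fW] Wu; have [h [hu hW]] := opn_line oW Wu.
have [p [q [qu pq]]] := fW _ Wu.
have [p' pE] := meval1_horner p; have [q' qE] := meval1_horner q.
exists (p' * h), (q' * h); rewrite hornerM -qE mulf_neq0 //; split=> // u.
rewrite !hornerM mulf_eq0 negb_or => /andP[qu' hu']; split; first exact: hW.
by rewrite pq ?qE ?pE //; [field|exact: hW].
Qed.

Lemma reg_torus (W : set (Gm k)) f t0 : reg W f -> W t0 ->
  exists p q : {poly k}, q.[sval t0 0 0] != 0 /\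
    forall t : Gm k, q.[sval t 0 0] != 0 ->
      W t /\ f t * q.[sval t 0 0] = p.[sval t 0 0].
Proof.
move=> [[V oV WE] fW] Wt; have [V' [g [Vt rg fg]]] := fW _ Wt.
have [h [ht hV]] : exists h : {poly k}, h.[sval t0 0 0] != 0 /\
    forall u : 'rV_1, h.[u 0 0] != 0 -> V u.
  by apply: opn_line => //; rewrite WE in Wt.
have [p [q [qt pq]]] := reg_line rg Vt.
exists (p * h), (q * h); rewrite hornerM mulf_neq0 //; split=> // t.
rewrite !hornerM mulf_eq0 negb_or => /andP[qt' ht'].
have Wt' : W t by rewrite WE; apply: hV.
have [Vt' e] := pq _ qt'.
by split=> //; rewrite fg // mulrA e.
Qed.

Lemma opn_torus (W : set (Gm k)) t0 : opn W -> W t0 ->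
  exists h : {poly k}, h.[sval t0 0 0] != 0 /\
    forall t : Gm k, h.[sval t 0 0] != 0 -> W t.
Proof.
move=> [V oV WE] Wt; have [|h [ht hV]] := @opn_line V (sval t0) oV.
  by rewrite WE in Wt.
by exists h; split=> // t ht'; rewrite WE; apply: hV.
Qed.

Lemma bireg_torus (Y : fspace k) (U : set (Gm k)) (V : set Y) (h : Gm k * Y -> k) t0 :
    opn U -> bireg U V h -> U t0 ->
  exists D (q : {poly k}) (p : Y -> {poly k}),
    [/\ q.[sval t0 0 0] != 0, forall y, (size (p y) <= D)%N &
        forall (t : Gm k) y, q.[sval t 0 0] != 0 ->
          U t /\ h (t, y) * q.[sval t 0 0] = (p y).[sval t 0 0]].
Proof.
move=> oU [n [f [g [rf rg ->]]]] Ut.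
have [r [rt rU]] := opn_torus oU Ut.
have /fin_all_exists[pq pqP] i : exists pq : {poly k} * {poly k},
    pq.2.[sval t0 0 0] != 0 /\ forall t : Gm k, pq.2.[sval t 0 0] != 0 ->
      f i t * pq.2.[sval t 0 0] = pq.1.[sval t 0 0].
  have [p [q [qt pqE]]] := reg_torus (rf i) Ut.
  by exists (p, q); split=> // t /pqE[].
pose c i := (pq i).1 * \prod_(j < n | j != i) (pq j).2 * r.
exists (\max_(i < n) size (c i)), ((\prod_(i < n) (pq i).2) * r),
  (fun y => \sum_(i < n) g i y *: c i); split.
- rewrite hornerM horner_prod mulf_neq0 //; apply/prodf_neq0 => i _.
  by case: (pqP i).
- move=> y; apply: leq_trans (size_sum _ _ _) _; apply/bigmax_leqP => i _.
  by apply: leq_trans (size_scale_leq _ _) _; apply: (leq_bigmax i).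
- move=> t y; rewrite hornerM horner_prod mulf_eq0 negb_or => /andP[/prodf_neq0 qt rt'].
  split; first exact: rU.
  rewrite horner_sum mulr_suml; apply: eq_bigr => i _ /=.
  rewrite hornerZ !hornerM horner_prod (bigD1 i) //= -(pqP i).2 ?qt //; ring.
Qed.

(** A regular function on the product is locally a quotient of sums of products
    [f i t * g i y].  The [f i] are fractions in [t], so for each [y] this is a
    fraction in [t]; only its coefficients depend on [y], not its size. *)
Lemma reg_torus_product (Y : fspace k) (W : set (product (Gm k) Y)) f t0 y0 :
    is_fspace Y -> reg W f -> W (t0, y0) ->
  exists (V : set Y) D, [/\ opn V, V y0 & forall y, V y ->
    exists p q : {poly k},
      [/\ (size p <= D)%N, (size q <= D)%N, q.[sval t0 0 0] != 0 &
          forall t : Gm k, q.[sval t 0 0] != 0 -> W (t, y) ->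
            f (t, y) * q.[sval t 0 0] = p.[sval t 0 0]]].
Proof.
move=> fY [oW fW] Wty.
have [U [V [a [b [[oU oV] [ba bb] [Ut Vy] b0 fE]]]]] := fW _ Wty.
have [D1 [q1 [p1 [q1t sp1 E1]]]] := bireg_torus oU ba Ut.
have [D2 [q2 [p2 [q2t sp2 E2]]]] := bireg_torus oU bb Ut.
have rb : reg V (fun y => b (t0, y)).
  have [n [f' [g [_ rg ->]]]] := bb; apply: reg_sum => // i.
  exact: (regM fY (reg_cst fY (f' i t0) oV) (rg i)).
have rV := regV fY rb.
(* On this set the new denominator, which contains that of [b], is not zero. *)
exists (V `&` [set y | b (t0, y) != 0]),
  (maxn (D1 + (size q2 + size q2)) (D2 + (size q1 + size q2)))%N; split.
- exact: reg_opn rV.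
- by [].
move=> y [{}Vy /= by0].
exists (p1 y * (q2 * q2)), (p2 y * (q1 * q2)); split.
- apply: leq_trans (leq_maxl _ _); apply: leq_trans (size_mul_leq _ _) _.
  apply: leq_trans (leq_pred _) _; apply: leq_add => //.
  by apply: leq_trans (size_mul_leq _ _) _; apply: leq_pred.
- apply: leq_trans (leq_maxr _ _); apply: leq_trans (size_mul_leq _ _) _.
  apply: leq_trans (leq_pred _) _; apply: leq_add => //.
  by apply: leq_trans (size_mul_leq _ _) _; apply: leq_pred.
- rewrite !hornerM !mulf_neq0 //.
  by rewrite -(E2 t0 y q2t).2 mulf_neq0.
move=> t; rewrite !hornerM !mulf_eq0 !negb_or => /and3P[p2t q1t' q2t'] Wt.
have [{}Ut e2] := E2 t y q2t'; have [_ e1] := E1 t y q1t'.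
have bt0 : b (t, y) != 0 by move: p2t; rewrite -e2 mulf_eq0 negb_or => /andP[].
by rewrite -e1 -e2 (fE (t, y)) //; field.
Qed.

End LineAndTorus.

(** * Functions along the orbits *)

Section Orbits.
Variables (k : numClosedFieldType) (E : fspace k) (T : Gm_action E).
Hypothesis fE : is_fspace E.

Lemma torus_point (t : k) : t != 0 -> exists z : Gm k, sval z 0 0 = t.
Proof.
move=> t0; have tP : [set u : affine_space k 1 | u 0 0 != 0] (const_mx t).
  by rewrite /= mxE.
by exists (exist _ _ tP); rewrite /= mxE.
Qed.

Lemma act_regular_at t : t != 0 -> regular_on setT (T t).
Proof.
move=> t0; have [z zt] := torus_point t0.
have oT : opn (setT : set E) by apply: opnT.
have r1 := regular_on_pair fE (regular_on_cst z fE oT) (regular_on_id fE oT).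
apply: regular_on_eq fE (regular_on_compT r1 (act_regular T)) _ => x _ /=.
by rewrite zt.
Qed.

Variables (O : set E) (F : E -> k).
Hypothesis rF : reg O F.
Hypothesis O_stable : forall t e, t != 0 -> O e -> O (T t e).

Lemma orbit_fraction (e0 : E) t0 : O e0 -> t0 != 0 ->
  exists (V : set E) D, [/\ opn V, V e0 & forall e, V e -> O e ->
    exists p q : {poly k}, [/\ (size p <= D)%N, (size q <= D)%N, q.[t0] != 0 &
      fraction_on (fun t => F (T t e)) p q]].
Proof.
move=> Oe t00; have [z zt] := torus_point t00.
have [_ /(_ _ _ rF) r] := act_regular T.
have [|V [D [oV Ve VD]]] := reg_torus_product fE r (t0 := z) (y0 := e0).
  by rewrite /preimage /= zt; apply: O_stable.
exists V, D; split=> // e {}Ve Oe'; have [p [q [sp sq qt pq]]] := VD e Ve.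
exists p, q; split; rewrite -?zt // => t tn0 qt'.
have [y yt] := torus_point tn0.
by have := pq y; rewrite /preimage /= yt; apply=> //; apply: O_stable.
Qed.

(** Orbits are followed to their limit at 0 or at infinity; with [t] replaced by
    [twist inv t], both ends become [t = 0]. *)
Definition twist (inv : bool) (t : k) := if inv then t^-1 else t.

Lemma twist_neq0 inv t : t != 0 -> twist inv t != 0.
Proof. by case: inv; rewrite /= ?invr_eq0. Qed.

Lemma twistM inv t t' : twist inv (t * t') = twist inv t * twist inv t'.
Proof. by case: inv; rewrite //= invfM. Qed.

Lemma twist_expz inv t (n : int) : twist inv t ^ n = t ^ (if inv then - n else n).
Proof. by case: inv; rewrite //= exprz_inv. Qed.

(** The fractions of bounded size that represent [t |-> F (T t e)] make it a Laurent
    polynomial with exponents in a range that does not depend on [e].  By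
    interpolation its coefficients are combinations of the functions
    [e |-> F (T t e)] for finitely many values of [t], and these are regular. *)
Lemma orbit_laurent_bounded (e0 : E) : O e0 ->
  exists (V : set E) D K (l : E -> {poly k}),
    [/\ opn V, V e0, forall e, (size (l e) <= K)%N,
        forall i, reg V (fun e => (l e)`_i) &
        forall e t, V e -> t != 0 -> F (T t e) * t ^+ D = (l e).[t]].
Proof.
move=> Oe0; have [V [D [oV Ve VD]]] := orbit_fraction Oe0 (oner_neq0 k).
pose K := (D + D)%N.
have oVO : opn (V `&` O) by apply: opnI => //; exact: reg_opn rF.
have lau e : V e -> O e -> exists2 l : {poly k}, (size l <= K)%N &
    forall t, t != 0 -> F (T t e) * t ^+ D = l.[t].
  move=> {}Ve Oe; have [p [q [sp sq q1 pq]]] := VD e Ve Oe.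
  apply: (@laurent_of_local _ (fun t => F (T t e)) D p q) => //.
  - exact: horner_neq0 q1.
  move=> t t0; have [V' [D' [_ Ve' VD']]] := orbit_fraction Oe t0.
  by have [p' [q' [_ _ q't pq']]] := VD' _ Ve' Oe; exists p', q'.
have [A AE] := coef_interpolation k K.
pose c i e := if insub i is Some i' then
  \sum_(j < K) F (T j.+1%:R e) * (j.+1%:R ^+ D * A j i') else 0.
exists (V `&` O), D, K, (fun e => \poly_(i < K) c i e); split=> //.
- move=> i; apply: (@reg_eq _ _ _ (c i) _ fE); last first.
    by move=> e _; rewrite coef_poly /c; case: ltnP => // iK; rewrite insubN // -leqNgt.
  rewrite /c; case: insubP => [i' _ _|_]; last exact: reg_cst.
  apply: reg_sum => // j; apply: (regM fE); last exact: reg_cst.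
  have j0 : j.+1%:R != 0 :> k by rewrite pnatr_eq0.
  apply: (reg_sub fE oVO _ ((act_regular_at j0).2 _ _ rF)) => e [_ Oe].
  by split=> //; apply: O_stable.
- move=> e t [Ve' Oe] t0; have [l sl lE] := lau e Ve' Oe.
  rewrite lE //; congr (_.[t]); apply/polyP => i; rewrite coef_poly.
  case: ltnP => iK; last by rewrite nth_default // (leq_trans sl).
  rewrite /c insubT (AE _ sl (Ordinal iK)); apply: eq_bigr => j _.
  by rewrite -lE ?pnatr_eq0 // mulrA.
Qed.

(** At infinity the polynomials are reversed.  The lower bound [b] on the
    exponent [D] leaves room for a later shift by an integer exponent. *)
Lemma orbit_laurent inv (e0 : E) b : O e0 ->
  exists (V : set E) D (l : E -> {poly k}),
    [/\ opn V, V e0, (b <= D)%N, forall i, reg V (fun e => (l e)`_i) &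
        forall e t, V e -> t != 0 -> F (T (twist inv t) e) * t ^+ D = (l e).[t]].
Proof.
move=> /orbit_laurent_bounded[V [D [K [l [oV Ve sl rl lE]]]]].
case: inv => /=; last first.
  exists V, (D + b)%N, (fun e => 'X^b * l e); split=> //; first exact: leq_addl.
  - move=> i; apply: (@reg_eq _ _ _ (fun e => if (i < b)%N then 0 else (l e)`_(i - b)) _ fE).
      by case: (ltnP i b) => // _; apply: reg_cst.
    by move=> e _; rewrite coefXnM.
  - by move=> e t Ve' t0; rewrite hornerM hornerXn -lE // exprD; ring.
pose D' := (K + b)%N; pose N := (D + D')%N.
exists V, D', (fun e => \poly_(i < N.+1) (l e)`_(N - i)); split=> //; first exact: leq_addl.
- move=> i; apply: (@reg_eq _ _ _ (fun e => if (i < N.+1)%N then (l e)`_(N - i) else 0) _ fE).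
    by case: (ltnP i N.+1) => // _; apply: reg_cst.
  by move=> e _; rewrite coef_poly.
- move=> e t Ve' t0; have tV0 : t^-1 != 0 by rewrite invr_eq0.
  have sN : (size (l e) <= N.+1)%N.
    by apply: leq_trans (sl e) _; rewrite /N /D' addnCA -addnS leq_addr.
  have -> : (\poly_(i < N.+1) (l e)`_(N - i)).[t] = t ^+ N * (l e).[t^-1].
    rewrite horner_poly (horner_coef_wide _ sN) mulr_sumr (reindex_inj rev_ord_inj) /=.
    apply: eq_bigr => i _; have iN : (i <= N)%N by rewrite -ltnS.
    by rewrite subSS subKn // exprVn expfB_cond ?(negbTE t0) //; ring.
  rewrite -lE // exprVn /N exprD.
  by field; rewrite expf_neq0.
Qed.

Lemma orbit_laurent_at inv e : O e ->
  exists N (l : {poly k}), forall t, t != 0 -> F (T (twist inv t) e) * t ^+ N = l.[t].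
Proof.
move=> Oe; have [V [D [l [_ Ve _ _ lE]]]] := orbit_laurent inv 0 Oe.
by exists D, (l e) => t; apply: lE.
Qed.

End Orbits.

(** * Leading terms on the attracting cells *)

Section LeadingTerm.
Variables (k : numClosedFieldType) (X : fspace k).
Hypothesis fX : is_fspace X.
Variables (T : Gm_action X) (L : line_bundle X) (TL : linearization T L).
Variables (m n : nat) (F : 'I_n -> tot L -> k).
Hypothesis cF : is_coordinates m F.

Let fE := is_fspace_tot L.

Lemma lin_act_nonzero t (e : tot L) : t != 0 -> nonzero e -> nonzero (TL t e).
Proof.
move=> t0 ne; rewrite /nonzero -lin_scl // => e1; apply: ne.
rewrite -(act1 TL (scl 0 e)) -[RHS](act1 TL) -(mulVf t0).
by rewrite !actM ?invr_eq0 // e1.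
Qed.

(** The coordinates along the orbit of [e] have no terms of degree less than [a], and
    their terms of degree [a] are proportional to the coordinates of [ev].  The
    case [c = 0] has to be allowed, because it occurs on the boundary of a
    cell. *)
Definition leading_term inv (a : int) (ev e : tot L) :=
  exists c, forall i, exists q : {poly k},
    (forall t, t != 0 -> F i (TL (twist inv t) e) = t ^ a * q.[t]) /\
    q.[0] = c * F i ev.

(** The coordinates are homogeneous of degree [-m], and [t] acts by [t ^ (- w)] on the
    fiber at [v]: these are their exponents along the constant orbit [v]. *)
Definition weight_exponent (inv : bool) (w : int) := if inv then - (w * m%:Z) else w * m%:Z.

(** [lim_zero] and [lim_infty] are the cases [false] and [true]. *)
Definition limit inv x v := exists g : affine_space k 1 -> X,
  [/\ regular_map g, g 0 = v &
      forall z : 'rV[k]_1, z 0 0 != 0 -> g z = T (twist inv (z 0 0)) x].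

Lemma leading_term_scl inv a ev b e : b != 0 -> nonzero e ->
  leading_term inv a ev e -> leading_term inv a ev (scl b e).
Proof.
move=> b0 ne [c cE]; exists ((b ^+ m)^-1 * c) => i; have [q [qE q0]] := cE i.
exists ((b ^+ m)^-1 *: q); rewrite hornerZ q0 mulrA; split=> // t t0.
have tw0 := twist_neq0 inv t0; rewrite lin_scl // (coordinates_scl cF) //.
  by rewrite qE // hornerZ; ring.
exact: lin_act_nonzero.
Qed.

Variables (v : X) (w : int).
Hypothesis v_weight : fiber_weight TL v w.

(** The orbit map extends to the line, and a local frame of [L] around [v]
    compares the coordinates along the orbit of [e] with those of a family of
    vectors that is regular and nonzero at 0.  The weight of the fiber at [v] is
    the effect of [t = 2] on this family at 0. *)
Lemma limit_leading_term inv x e ev : limit inv x v -> nonzero e -> proj e = x ->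
  nonzero ev -> proj ev = v -> leading_term inv (weight_exponent inv w) ev e.
Proof.
move=> [g [rg g0 gE]] ne pe nev pev.
have [U [s [be [fr Uv]]]] := frame_exists fX L v.
pose A1 := affine_space k 1.
pose pnt t : A1 := const_mx t.
have pntE t : pnt t 0 0 = t by rewrite mxE.
have pnt0 : pnt 0 = 0 by apply/matrixP => ? ?; rewrite !mxE.
have two0 : (2 : k) != 0 by rewrite pnatr_eq0.
have tw20 := twist_neq0 inv two0.
have oU : opn (g @^-1` U) by case: rg => o _; apply/o/(frame_opn fr).
have [h [h0 hU]] : exists h : {poly k}, h.[(0 : 'rV_1) 0 0] != 0 /\
    forall u : 'rV_1, h.[u 0 0] != 0 -> U (g u).
  by apply: opn_line => //; rewrite /preimage /= g0.
rewrite mxE in h0.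
pose A i t := F i (s (g (pnt t))).
pose B i t := F i (TL (twist inv 2) (s (g (pnt t)))).
have rs : @regular_on _ A1 (tot L) (g @^-1` U) (s \o g).
  by have := regular_on_comp (regular_onT rg) (frame_regular fr); rewrite setTI.
have rats (S : tot L -> tot L) i : regular_on setT S ->
    (forall e, nonzero e -> nonzero (S e)) -> rational_at0 (fun t => F i (S (s (g (pnt t))))).
  move=> rS nS; have r2 := regular_on_comp rs rS.
  have [|p [q [q0 pq]]] := reg_line (r2.2 _ _ (coordinates_reg cF i)) (u0 := 0).
    split; first by split=> //; rewrite /preimage /= g0.
    by rewrite /preimage /=; apply: nS; rewrite g0; exact: (frame_nonzero fr).
  exists p, q; rewrite mxE in q0; split=> // t qt.
  by have [] := pq (pnt t); rewrite pntE.
have [c cE] : exists c, forall i, exists q : {poly k},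
    (forall t, t != 0 -> F i (TL (twist inv t) e) = t ^ (weight_exponent inv w) * q.[t]) /\
    q.[0] = c * A i 0.
  have [j Aj] := coordinates_neq0 cF (frame_nonzero fr Uv).
  apply: (laurent_order (h := h) (B := B) (j := j)) => //.
  - move=> i; apply: (orbit_laurent_at fE (coordinates_reg cF i)) => //.
    by move=> t e' t0; apply: lin_act_nonzero.
  - by move=> i; apply: (rats id) => //; apply/regular_on_id => //; apply: opnT.
  - move=> i; apply: rats => [|e' ne']; first exact: act_regular_at.
    exact: lin_act_nonzero.
  - move=> i; rewrite /B /A pnt0 g0 v_weight //; last exact: (frame_section fr).
    rewrite (coordinates_scl cF) ?expfz_neq0 //; last exact: (frame_nonzero fr).
    congr (_ * _); rewrite exprnP exprz_exp invr_expz twist_expz /weight_exponent.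
    by rewrite mulNr !opprK.
  - by rewrite /A pnt0 g0.
  - move=> t t0 ht; have Ut : U (g (pnt t)) by apply: hU; rewrite pntE.
    have gt : g (pnt t) = T (twist inv t) x by rewrite gE pntE.
    have [|a a0 eE] := nonzero_fiber_spanned fX (frame_nonzero fr Ut)
        (lin_act_nonzero (twist_neq0 inv t0) ne).
      by rewrite (frame_section fr) // gt lin_proj ?twist_neq0 // pe.
    exists (a ^+ m)^-1; first by rewrite invr_eq0 expf_neq0.
    move=> i; rewrite twistM actM ?twist_neq0 // eE lin_scl //.
    have ns := frame_nonzero fr Ut.
    by rewrite !(coordinates_scl cF) //; apply: lin_act_nonzero.
have [b b0 evE] : exists2 b, b != 0 & ev = scl b (s v).
  apply: (nonzero_fiber_spanned fX) => //; first exact: (frame_nonzero fr).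
  by rewrite (frame_section fr).
exists (c * b ^+ m) => i; have [q [qE q0]] := cE i; exists q; split=> //.
rewrite q0 evE (coordinates_scl cF) //; last exact: (frame_nonzero fr).
by rewrite /A pnt0 g0; field; rewrite expf_neq0.
Qed.

(** The set where [r \o s] is regular and nonzero is open, so it meets [C] as soon as
    it contains a point of the closure. *)
Lemma zclosure_vanish (C : set X) z (U : set X) (s : X -> tot L) (V : set (tot L)) r :
    zclosure C z -> regular_on U s -> U z -> reg V r -> V (s z) ->
    (forall y, U y -> V (s y) -> C y -> r (s y) = 0) ->
  r (s z) = 0.
Proof.
move=> Cz rs Uz rr Vz vanish; apply: contrapT => /eqP rz.
have oW := rs.1 _ (reg_opn fE (regV fE rr)).
have [|y [Uy [Vy /= ry]] Cy] := zclosure_meets_open fX Cz oW; first by [].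
by rewrite vanish ?eqxx in ry.
Qed.

(** The conditions in [leading_term], with [c] eliminated by comparing the
    coordinates two by two, are equations between the coefficients of the
    Laurent polynomials [F i (t . e)], which are regular functions of [e]. *)
Lemma zclosure_leading_term inv z e ev :
    zclosure [set x | limit inv x v] z -> nonzero e -> proj e = z ->
    nonzero ev -> proj ev = v ->
  leading_term inv (weight_exponent inv w) ev e.
Proof.
move=> Cz ne pe nev pev; set a : int := weight_exponent inv w.
have [U [s [be [fr Uz]]]] := frame_exists fX L z.
have nsz := frame_nonzero fr Uz.
have [b b0 ->] : exists2 b, b != 0 & e = scl b (s z).
  by apply: (nonzero_fiber_spanned fX) => //; rewrite (frame_section fr).
apply: leading_term_scl => //.
pose expansion i y (q : {poly k}) :=
  forall t, t != 0 -> F i (TL (twist inv t) (s y)) = t ^ a * q.[t].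
(* [l (s y)] is [t ^ D] times the coordinate along the orbit, and [N = D + a]. *)
have local i : exists (V : set (tot L)) N (l : tot L -> {poly k}),
    [/\ V (s z), forall j, reg V (fun e => (l e)`_j) &
        forall y q, V (s y) -> expansion i y q <-> l (s y) = 'X^N * q].
  have [|V [D [l [oV Ve aD rl lE]]]] := @orbit_laurent _ _ TL fE _ _
      (coordinates_reg cF i) _ inv (s z) (absz a) nsz.
    by move=> t e' t0; apply: lin_act_nonzero.
  pose N := absz (D%:Z + a).
  have NE : N%:Z = D%:Z + a.
    rewrite /N gez0_abs // -lerBlDr sub0r; apply: le_trans (_ : (absz a)%:Z <= _).
      by rewrite abszE -normrN ler_norm.
    by rewrite lez_nat.
  exists V, N, l; split=> // y q Vy.
  have tN t : t != 0 -> t ^+ N = t ^+ D * t ^ a :> k.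
    by move=> t0; rewrite exprnP NE expfzDr.
  split=> [qE|lq t t0].
    apply: poly_ext_neq0 => t t0; rewrite -lE // qE // hornerM hornerXn tN //; ring.
  apply: (mulIf (expf_neq0 D t0)); rewrite lE // lq hornerM hornerXn tN //; ring.
(* Proportionality to the coordinates of [ev], as the vanishing of minors. *)
have pair i j : exists qi qj, [/\ expansion i z qi, expansion j z qj &
    qi.[0] * F j ev = qj.[0] * F i ev].
  have [Vi [Ni [li [Viz rli liE]]]] := local i.
  have [Vj [Nj [lj [Vjz rlj ljE]]]] := local j.
  have cell y : U y -> limit inv y v -> exists c, forall i, exists q,
      expansion i y q /\ q.[0] = c * F i ev.
    move=> Uy Cy; apply: (limit_leading_term Cy) => //; first exact: (frame_nonzero fr).
    exact: (frame_section fr).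
  have low i' (V : set (tot L)) N (l : tot L -> {poly k}) :
      V (s z) -> (forall j, reg V (fun e => (l e)`_j)) ->
      (forall y q, V (s y) -> expansion i' y q <-> l (s y) = 'X^N * q) ->
      l (s z) = 'X^N * drop_poly N (l (s z)).
    move=> Vz rl lE; apply/polyP => r; rewrite coefXnM.
    case: ltnP => rN; last by rewrite coef_drop_poly subnK.
    apply: (zclosure_vanish Cz (frame_regular fr) Uz (rl r) Vz) => y Uy Vy Cy.
    have [c /(_ i')[q [/(lE _ _ Vy) -> _]]] := cell y Uy Cy.
    by rewrite coefXnM rN.
  exists (drop_poly Ni (li (s z))), (drop_poly Nj (lj (s z))); split.
  - by apply/liE => //; apply: low Viz rli liE.
  - by apply/ljE => //; apply: low Vjz rlj ljE.
  rewrite !horner_coef0 !coef_drop_poly !add0n; apply/eqP; rewrite -subr_eq0; apply/eqP.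
  have rV : reg (Vi `&` Vj) (fun e => (li e)`_Ni * F j ev - (lj e)`_Nj * F i ev).
    have oV : opn (Vi `&` Vj).
      by apply: opnI => //; [exact: reg_opn (rli 0)|exact: reg_opn (rlj 0)].
    have r1 : reg (Vi `&` Vj) (fun e => (li e)`_Ni * F j ev).
      by apply: (regM fE); [apply: (reg_sub fE oV _ (rli _)) => ? []|exact: reg_cst].
    have r2 : reg (Vi `&` Vj) (fun e => (lj e)`_Nj * - F i ev).
      by apply: (regM fE); [apply: (reg_sub fE oV _ (rlj _)) => ? []|exact: reg_cst].
    by apply: reg_eq (regD fE r1 r2) _ => // e' _; rewrite mulrN.
  apply: (zclosure_vanish Cz (frame_regular fr) Uz rV) => // y Uy [Viy Vjy] Cy.
  have [c cE] := cell y Uy Cy.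
  have [qi [/(liE _ _ Viy) -> qi0]] := cE i.
  have [qj [/(ljE _ _ Vjy) -> qj0]] := cE j.
  by rewrite !coefXnM !ltnn !subnn -!horner_coef0 qi0 qj0; ring.
(* The factor [c] is read off at a coordinate of [ev] that is not zero. *)
have [j Fj] := coordinates_neq0 cF nev.
have [_ [qj [_ qjE _]]] := pair j j.
exists (qj.[0] / F j ev) => i; have [qi [qj' [qiE qjE' e0]]] := pair i j.
exists qi; split=> //; have <- : qj' = qj.
  apply: poly_ext_neq0 => t t0; apply: (mulfI (expfz_neq0 a t0)).
  by rewrite -qjE // -qjE'.
by apply: (mulIf Fj); rewrite e0; field.
Qed.

End LeadingTerm.

(** * Comparison of the two ends *)

Section Comparison.
Variables (k : numClosedFieldType) (X : fspace k).
Hypothesis fX : is_fspace X.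
Variables (T : Gm_action X) (L : line_bundle X) (TL : linearization T L).
Variables (m n : nat) (F : 'I_n -> tot L -> k).
Hypothesis cF : is_coordinates m F.

(** Each coordinate along the orbit of [e] is [t ^ (a * m) * q t] and also
    [t ^ (b * m) * p (1 / t)].  If [b <= a], then [t ^ r * q t = p (1 / t)] with
    [r = (a - b) * m], so both sides are constant.  For [r > 0] the constant is 0,
    which is impossible for all coordinates at once; for [r = 0] it is
    proportional to the coordinates of [ev] and to those of [ew]. *)
Lemma leading_terms_compare (v w : X) (a b : int) (e ev ew : tot L) :
    (0 < m)%N -> nonzero e ->
    nonzero ev -> proj ev = v -> nonzero ew -> proj ew = w ->
    leading_term TL F false (weight_exponent m false a) ev e ->
    leading_term TL F true (weight_exponent m true b) ew e ->
  v = w \/ a < b.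
Proof.
move=> m0 ne nev pev new pew [c cE] [d dE].
have [ab|ba] := ltP a b; [by right|left].
have [r rE] : exists r : nat, r%:Z = (a - b) * m%:Z.
  exists (absz ((a - b) * m%:Z)); rewrite gez0_abs //.
  by rewrite mulr_ge0 // subr_ge0.
have polys i : exists q p : {poly k}, [/\ q.[0] = c * F i ev, p.[0] = d * F i ew,
    F i e = q.[1] & forall t, t != 0 -> t ^+ r * q.[t] = p.[t^-1]].
  have [q [qE q0]] := cE i; have [p [pE p0]] := dE i.
  exists q, p; split=> // [|t t0].
    by rewrite -[e in LHS](act1 TL) (qE 1 (oner_neq0 _)) exp1rz mul1r.
  have tV0 : t^-1 != 0 by rewrite invr_eq0.
  have := pE _ tV0; rewrite /= invrK (qE t t0) exprz_inv opprK => e1.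
  apply: (mulfI (expfz_neq0 (b * m%:Z) t0)); rewrite -e1 mulrA exprnP -expfzDr // rE.
  by congr (t ^ _ * _); rewrite /=; ring.
have qconst q p : (forall t, t != 0 -> t ^+ r * q.[t] = p.[t^-1]) ->
    'X^r * q = (0 ^+ r * q.[0])%:P :> {poly k} /\ 0 ^+ r * q.[0] = p.[0] :> k.
  move=> qp; have := @poly_inv_const k ('X^r * q) p.
  by rewrite hornerM hornerXn; apply=> t t0; rewrite hornerM hornerXn qp.
have [r0|r0] := posnP r; last first.
  have [i Fi] := coordinates_neq0 cF ne.
  have [q [p [_ _ q1 qp]]] := polys i; case: (qconst q p qp).
  rewrite expr0n gtn_eqF // mul0r => /(congr1 (horner^~ 1)).
  by rewrite hornerM hornerXn expr1n mul1r hornerC => q10; rewrite q1 q10 eqxx in Fi.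
have Fe i : F i e = c * F i ev /\ F i e = d * F i ew.
  have [q [p [q0 p0 q1 qp]]] := polys i; have := qconst q p qp.
  rewrite r0 expr0 !mul1r => -[/(congr1 (horner^~ 1)) q10 qp0].
  by rewrite q1 q10 hornerC -p0 -qp0 -q0.
have [i Fi] := coordinates_neq0 cF ne.
have c0 : c != 0 by apply: contraNneq Fi => c0; rewrite (Fe i).1 c0 mul0r.
have d0 : d != 0 by apply: contraNneq Fi => d0; rewrite (Fe i).2 d0 mul0r.
rewrite -pev -pew.
rewrite -(coordinates_inj cF c0 ne nev (fun i => (Fe i).1)).
by rewrite -(coordinates_inj cF d0 ne new (fun i => (Fe i).2)).
Qed.

End Comparison.

Theorem theorem9 (R : realType) (X : fspace R[i])
  (X_variety : is_variety X) (X_complete : is_complete X)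
  (T : Gm_action X) (T_isolated : isolated_fixed_points T)
  (L : line_bundle X) (TL : linearization T L) (L_ample : ample L)
  (Phi : X -> int) (Phi_weight : forall v, fixed T v -> fiber_weight TL v (Phi v))
  (v w : X) (v_fixed : fixed T v) (w_fixed : fixed T w) :
  zclosure (plus_cell T v) `&` zclosure (minus_cell T w) !=set0 ->
  v = w \/ Phi v < Phi w.
Proof.
have fX : is_fspace X by case: X_variety.
have [m [n [F [m0 cF]]]] := ample_coordinates fX L_ample.
have vec x : exists e : tot L, nonzero e /\ proj e = x.
  have [U [s [be [fr Ux]]]] := frame_exists fX L x.
  by exists (s x); split; [exact: (frame_nonzero fr)|exact: (frame_section fr)].
move=> [z [zv zw]].
have [e [ne pe]] := vec z; have [ev [nev pev]] := vec v; have [ew [new pew]] := vec w.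
have lv := zclosure_leading_term fX cF (Phi_weight v v_fixed) (inv := false) zv ne pe nev pev.
have lw := zclosure_leading_term fX cF (Phi_weight w w_fixed) (inv := true) zw ne pe new pew.
exact (leading_terms_compare cF m0 ne nev pev new pew lv lw).
Qed.
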